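(* Let $\Bbbk$ be a field, let $q\in\Bbbk^*$ be not a root of unity, let $\sigma_q$ be the automorphism of $\Bbbk[h^{\pm 1}]$ with $\sigma_q(h)=qh$, and let $a=a(h)\in\Bbbk[h^{\pm 1}]$ be not a monomial. Let $A=\Bbbk[h^{\pm 1}](\sigma_q,a)$. 1. Every ($\Bbbk$-linear) derivation of $A$ can be uniquely written as $\mathrm{ad}_t+\delta_\alpha$ (that is, the derivations $\mathrm{ad}_t$ and $\delta_\alpha$ are uniquely determined), where $t\in A$, $\alpha\in\Bbbk$, and $\delta_\alpha$ is the derivation of $A$ with action $\delta_\alpha(h)=0$, $\delta_\alpha(x)=\alpha x$ and $\delta_\alpha(y)=-\alpha y$. 2. The first Hochschild cohomology is $\mathrm{HH}^1(A)=\Bbbk$.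
   Context: For a $\Bbbk$-algebra $R$, a $\Bbbk$-algebra automorphism $\sigma$ of $R$ and a central element $a\in R$, the (degree-one) generalized Weyl algebra $R(\sigma,a)$ is the $\Bbbk$-algebra extension of $R$ generated by two indeterminates $x$ and $y$ subject to the relations $yx=a$, $xy=\sigma(a)$, $xr=\sigma(r)x$ and $yr=\sigma^{-1}(r)y$ for all $r\in R$. A monomial in $\Bbbk[h^{\pm 1}]$ is an element $c h^i$ with $c\in\Bbbk$ and $i\in\mathbb{Z}$ (so a non-monomial is in particular nonzero). A derivation is a $\Bbbk$-linear map satisfying $\mathrm{D}(uv)=\mathrm{D}(u)v+u\mathrm{D}(v)$; the inner derivation $\mathrm{ad}_t$ is $\mathrm{ad}_t(u)=tu-ut$. $\mathrm{HH}^1(A)$ is the space of $\Bbbk$-linear derivations of $A$ modulo inner derivations.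
   Formalization: If the field has characteristic p > 0, it is also assumed that the exponents of a are not all congruent mod p; otherwise a = h^j b(h^p) and h ↦ h, x ↦ jx, y ↦ 0 is a derivation not of the form ad_t + δ_α, so the claim fails (e.g. a = 1 + h^p). *)

(* Defs.v *)
From HB Require Import structures.
From mathcomp Require Import all_boot all_order all_algebra.
From mathcomp Require Import generic_quotient ring_quotient.
From mathcomp Require Import finmap.
From mathcomp Require Import boolp functions.
From mathcomp Require Import monalg.

Set Implicit Arguments.
Unset Strict Implicit.
Unset Printing Implicit Defensive.

Import GRing.Theory.
Local Open Scope ring_scope.
Local Open Scope quotient_scope.

(* -------------------------------------------------------------------- *)
(* Laurent polynomials K[h^{+-1}]: finitely supported families of        *)
(* coefficients indexed by int.  Only the module structure of [malg] is  *)
(* reused, because [monomType] excludes monoids with nontrivial units.   *)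

Definition laurent (K : comNzRingType) : Type := {malg K[int]}.

Section LinearExtension.
Variables (K : comNzRingType).

HB.instance Definition _ := GRing.Lmodule.on (laurent K).

Definition lext (V : lmodType K) (F : int -> V) (f : laurent K) : V :=
  \sum_(i <- msupp f) f@_i *: F i.

Lemma lextEw (V : lmodType K) (F : int -> V) (E : {fset int}) (f : laurent K) :
  (msupp f `<=` E)%fset -> lext F f = \sum_(i <- E) f@_i *: F i.
Proof.
move=> le; rewrite [LHS](big_fset_incl _ le) => //= i _ /mcoeff_outdom ->.
by rewrite scale0r.
Qed.

Lemma lextP (V : lmodType K) (F : int -> V) c (f g : laurent K) :
  lext F (c *: f + g) = c *: lext F f + lext F g.
Proof.
pose E := (msupp f `|` msupp g `|` msupp (c *: f + g : laurent K))%fset.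
rewrite !(@lextEw _ _ E) /E; first last.
- by rewrite fsubsetUr.
- by rewrite -fsetUA fsubsetUl.
- by rewrite fsetUAC fsubsetUr.
rewrite scaler_sumr -big_split /=; apply: eq_bigr => i _.
by rewrite mcoeffD mcoeffZ scalerDl scalerA.
Qed.

HB.instance Definition _ (V : lmodType K) (F : int -> V) :=
  GRing.isLinear.Build K (laurent K) V _ (lext F) (lextP F).

Lemma lextU (V : lmodType K) (F : int -> V) c i :
  lext F (<< c *g i >> : laurent K) = c *: F i.
Proof.
by rewrite (@lextEw _ _ [fset i]%fset) ?msuppU_le // big_seq_fset1 mcoeffUU.
Qed.

Lemma lext_id (f : laurent K) : lext (fun i => << 1 *g i >> : laurent K) f = f.
Proof.
rewrite [RHS]monalgE /lext; apply: eq_bigr => i _; apply/malgP => j.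
by rewrite mcoeffZ !mcoeffU; case: eqP => _; rewrite ?mulr1 ?mulr0.
Qed.

Lemma lext_comp (V W : lmodType K) (phi : {linear V -> W}) (F : int -> V) f :
  phi (lext F f) = lext (fun i => phi (F i)) f.
Proof. by rewrite /lext linear_sum; apply: eq_bigr => i _; rewrite linearZ. Qed.

Lemma eq_lext (V : lmodType K) (F G : int -> V) : F =1 G -> lext F =1 lext G.
Proof. by move=> FG f; apply: eq_bigr => i _; rewrite FG. Qed.

Definition lone : laurent K := << 1 *g 0%Z >>.

Definition lmul (f g : laurent K) : laurent K :=
  lext (fun i => lext (fun j => << 1 *g (i + j) >> : laurent K) g) f.

Lemma lmulA : associative lmul.
Proof.
move=> f g k; rewrite /lmul lext_comp; apply: eq_lext => i.
rewrite !lext_comp; apply: eq_lext => j /=.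
rewrite lextU scale1r lext_comp; apply: eq_lext => l /=.
by rewrite lextU scale1r addrA.
Qed.

Lemma lmulC : commutative lmul.
Proof.
move=> f g; rewrite /lmul /lext.
under eq_bigr => i _ do rewrite scaler_sumr.
rewrite exchange_big; apply: eq_bigr => j _ /=.
rewrite scaler_sumr; apply: eq_bigr => i _.
by rewrite !scalerA mulrC addrC.
Qed.

Lemma lmul1 : left_id lone lmul.
Proof.
move=> f; rewrite /lmul lextU scale1r -[RHS]lext_id.
by apply: eq_lext => i; rewrite add0r.
Qed.

Lemma lmulDl : left_distributive lmul +%R.
Proof. by move=> f g k; rewrite /lmul linearD. Qed.

Lemma lone_neq0 : lone != 0.
Proof.
apply/eqP => /(congr1 (fun f : {malg K[int]} => f@_(0%Z))).
by rewrite mcoeffUU mcoeff0; apply/eqP; rewrite oner_eq0.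
Qed.

HB.instance Definition _ := GRing.Zmodule_isComNzRing.Build (laurent K)
  lmulA lmulC lmul1 lmulDl lone_neq0.

Lemma lscaleAl (c : K) (f g : laurent K) : c *: (f * g) = c *: f * g.
Proof. by rewrite -[f * g]/(lmul f g) -[RHS]/(lmul _ _) /lmul linearZ. Qed.

HB.instance Definition _ := GRing.Lmodule_isLalgebra.Build K (laurent K) lscaleAl.
HB.instance Definition _ := GRing.Lalgebra_isComAlgebra.Build K (laurent K).

(* [lmono c i] is c h^i. *)
Definition lmono (c : K) (i : int) : laurent K := << c *g i >>.

Lemma lmonoM c d i j : lmono c i * lmono d j = lmono (c * d) (i + j).
Proof.
rewrite -[LHS]/(lmul _ _) /lmul !lextU scalerA; apply/malgP => l.
by rewrite mcoeffZ !mcoeffU; case: eqP => _; rewrite ?mulr1 ?mulr0.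
Qed.

End LinearExtension.

Definition lvar (K : comNzRingType) : laurent K := lmono 1 1.

(* If K has characteristic p and all exponents of a are congruent mod p, *)
(* i.e. a = h^j b(h^p), then h.a'(h) = j.a, and h |-> h, x |-> j.x,      *)
(* y |-> 0 defines a derivation of K[h^{+-1}](sigma_q, a) which is not   *)
(* inner modulo the derivations killing h.  The predicate excludes this  *)
(* case; it holds for every a when K has characteristic 0, and implies   *)
(* that a is not a monomial when K has positive characteristic.          *)
Definition pchar_generic (K : comNzRingType) (a : laurent K) : Prop :=
  forall p : nat, p \in [pchar K] ->
    ~ exists j : int, forall i : int, a@_i != 0 -> (i = j %[mod p])%Z.

Lemma pchar0_generic (K : comNzRingType) (a : laurent K) :
  [pchar K] =i pred0 -> pchar_generic a.
Proof. by move=> K0 p; rewrite K0. Qed.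

(* -------------------------------------------------------------------- *)

Record alg_aut (K : comNzRingType) (R : algType K) := AlgAut {
  aut_fun :> {lrmorphism R -> R};
  aut_inv : R -> R;
  aut_funK : cancel aut_fun aut_inv;
  aut_invK : cancel aut_inv aut_fun
}.

(* -------------------------------------------------------------------- *)
(* The generalized Weyl algebra R(sigma, a), as the quotient of the type *)
(* of ring expressions in x, y and the elements of R by the congruence   *)
(* generated by the ring axioms, the ring structure of R, and the        *)
(* defining relations.  Since sigma is K-linear, K is central in it.     *)

Inductive gwa_term (R : Type) : Type :=
| Coef of R
| GenX
| GenY
| Opp of gwa_term R
| Add of gwa_term R & gwa_term R
| Mul of gwa_term R & gwa_term R.
Arguments GenX {R}.
Arguments GenY {R}.

Section GWA.
Variables (K : comNzRingType) (R : algType K) (sigma : alg_aut R) (a : R).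
Local Notation sigmaV := (aut_inv sigma).

Inductive gwa_rel : gwa_term R -> gwa_term R -> Prop :=
| Grefl t : gwa_rel t t
| Gsym t u : gwa_rel t u -> gwa_rel u t
| Gtrans t u v : gwa_rel t u -> gwa_rel u v -> gwa_rel t v
| Gopp t t' : gwa_rel t t' -> gwa_rel (Opp t) (Opp t')
| Gadd t t' u u' :
    gwa_rel t t' -> gwa_rel u u' -> gwa_rel (Add t u) (Add t' u')
| Gmul t t' u u' :
    gwa_rel t t' -> gwa_rel u u' -> gwa_rel (Mul t u) (Mul t' u')
| GaddA t u v : gwa_rel (Add t (Add u v)) (Add (Add t u) v)
| GaddC t u : gwa_rel (Add t u) (Add u t)
| Gadd0 t : gwa_rel (Add (Coef 0) t) t
| GaddN t : gwa_rel (Add (Opp t) t) (Coef 0)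
| GmulA t u v : gwa_rel (Mul t (Mul u v)) (Mul (Mul t u) v)
| Gmul1l t : gwa_rel (Mul (Coef 1) t) t
| Gmul1r t : gwa_rel (Mul t (Coef 1)) t
| GmulDl t u v : gwa_rel (Mul (Add t u) v) (Add (Mul t v) (Mul u v))
| GmulDr t u v : gwa_rel (Mul t (Add u v)) (Add (Mul t u) (Mul t v))
| GcoefD r s : gwa_rel (Coef (r + s)) (Add (Coef r) (Coef s))
| GcoefM r s : gwa_rel (Coef (r * s)) (Mul (Coef r) (Coef s))
| Gyx : gwa_rel (Mul GenY GenX) (Coef a)
| Gxy : gwa_rel (Mul GenX GenY) (Coef (sigma a))
| Gxr r : gwa_rel (Mul GenX (Coef r)) (Mul (Coef (sigma r)) GenX)
| Gyr r : gwa_rel (Mul GenY (Coef r)) (Mul (Coef (sigmaV r)) GenY).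

Hypothesis a_central : forall r : R, a * r = r * a.

(* The remaining lemmas up to [gwa_rel_neq] show that R(sigma, a) is     *)
(* nonzero, by letting it act on sequences indexed by int.               *)

Definition aut_pow (n : int) (r : R) : R :=
  match n with Posz m => iter m sigma r | Negz m => iter m.+1 sigmaV r end.

Lemma aut_powS n r : aut_pow (n + 1) r = aut_pow n (sigma r).
Proof.
case: n => [m|[|m]].
- by rewrite -PoszD addn1 /= -iterS iterSr.
- by rewrite /= aut_funK.
- have -> : Negz m.+1 + 1 = Negz m by rewrite !NegzE -addn1 PoszD opprD addrNK.
  by rewrite /aut_pow [RHS]iterSr aut_funK.
Qed.

Lemma aut_powV n r : aut_pow (n - 1) r = aut_pow n (sigmaV r).
Proof. by rewrite -[n in RHS](subrK 1) aut_powS aut_invK. Qed.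

Lemma sigmaV_D r s : sigmaV (r + s) = sigmaV r + sigmaV s.
Proof. by rewrite -{1}[r](aut_invK sigma) -{1}[s](aut_invK sigma) -rmorphD aut_funK. Qed.

Lemma sigmaV_M r s : sigmaV (r * s) = sigmaV r * sigmaV s.
Proof. by rewrite -{1}[r](aut_invK sigma) -{1}[s](aut_invK sigma) -rmorphM aut_funK. Qed.

Lemma aut_powD n r s : aut_pow n (r + s) = aut_pow n r + aut_pow n s.
Proof.
case: n => m /=; last rewrite -sigmaV_D; first elim: m => //= m ->.
  by rewrite rmorphD.
by congr (sigmaV _); elim: m => //= m ->; rewrite sigmaV_D.
Qed.

Lemma aut_powM n r s : aut_pow n (r * s) = aut_pow n r * aut_pow n s.
Proof.
case: n => m /=; last rewrite -sigmaV_M; first elim: m => //= m ->.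
  by rewrite rmorphM.
by congr (sigmaV _); elim: m => //= m ->; rewrite sigmaV_M.
Qed.

Lemma aut_pow0 n : aut_pow n 0 = 0.
Proof. by apply: (addrI (aut_pow n 0)); rewrite -aut_powD !addr0. Qed.

Lemma sigmaV1 : sigmaV 1 = 1.
Proof. by rewrite -{1}(rmorph1 sigma) aut_funK. Qed.

Lemma aut_pow1 n : aut_pow n 1 = 1.
Proof.
case: n => m; first by elim: m => //= m ->; rewrite rmorph1.
by rewrite /aut_pow; elim: m.+1 => //= l ->; rewrite sigmaV1.
Qed.

Fixpoint gwa_act (t : gwa_term R) (f : int -> R) : int -> R :=
  match t with
  | Coef r => fun n => aut_pow n r * f n
  | GenX => fun n => f (n + 1)
  | GenY => fun n => aut_pow n a * f (n - 1)
  | Opp u => fun n => - gwa_act u f n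
  | Add u v => fun n => gwa_act u f n + gwa_act v f n
  | Mul u v => gwa_act u (gwa_act v f)
  end.

Lemma gwa_actD t f g n :
  gwa_act t (fun m => f m + g m) n = gwa_act t f n + gwa_act t g n.
Proof.
elim: t f g n => [r|||t IH|t IHt u IHu|t IHt u IHu] f g n //=.
- by rewrite mulrDr.
- by rewrite mulrDr.
- by rewrite IH opprD.
- by rewrite IHt IHu addrACA.
- by rewrite -IHt; congr (gwa_act t _ n); apply/funext => m; rewrite IHu.
Qed.

Lemma gwa_act_rel t u : gwa_rel t u -> gwa_act t = gwa_act u.
Proof.
elim=> {t u} //=.
- by move=> t u v _ -> _ ->.
- by move=> t t' _ ->.
- by move=> t t' u u' _ -> _ ->.
- by move=> t t' u u' _ -> _ ->.
- by move=> t u v; apply/funext=> f; apply/funext=> n; rewrite addrA.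
- by move=> t u; apply/funext=> f; apply/funext=> n; rewrite addrC.
- by move=> t; apply/funext=> f; apply/funext=> n; rewrite aut_pow0 mul0r add0r.
- by move=> t; apply/funext=> f; apply/funext=> n; rewrite aut_pow0 mul0r addNr.
- by move=> t; apply/funext=> f; apply/funext=> n; rewrite aut_pow1 mul1r.
- move=> t; apply/funext=> f; congr (gwa_act t _).
  by apply/funext=> n; rewrite aut_pow1 mul1r.
- by move=> t u v; apply/funext=> f; apply/funext=> n; rewrite gwa_actD.
- by move=> r s; apply/funext=> f; apply/funext=> n; rewrite aut_powD mulrDl.
- by move=> r s; apply/funext=> f; apply/funext=> n; rewrite aut_powM mulrA.
- by apply/funext=> f; apply/funext=> n; rewrite subrK.
- by apply/funext=> f; apply/funext=> n; rewrite addrK aut_powS.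
- by move=> r; apply/funext=> f; apply/funext=> n; rewrite aut_powS.
- move=> r; apply/funext=> f; apply/funext=> n; rewrite aut_powV !mulrA.
  by rewrite -!aut_powM a_central.
Qed.

Lemma gwa_rel_neq : ~ gwa_rel (Coef 1) (Coef 0).
Proof.
move=> /gwa_act_rel /(congr1 (fun F => F (fun=> 1) 0)) /=.
by rewrite !mulr1; apply/eqP; rewrite oner_eq0.
Qed.

End GWA.

Section GWAQuotient.
Variables (K : comNzRingType) (R : algType K) (sigma : alg_aut R) (a : R).
Hypothesis a_central : forall r : R, a * r = r * a.
Local Notation sigmaV := (aut_inv sigma).

Definition gwa_carrier : Type := {classic gwa_term R}.
HB.instance Definition _ := Choice.on gwa_carrier.

Definition gwa_relb (t u : gwa_carrier) : bool := `[< gwa_rel sigma a t u >].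

Lemma gwa_relb_equiv : equiv_class_of gwa_relb.
Proof.
split.
- by move=> t; apply/asboolP/Grefl.
- by move=> t u; apply: asbool_equiv_eq; split=> /Gsym.
- by move=> t u v /asboolP ut /asboolP uv; apply/asboolP; apply: Gtrans ut uv.
Qed.
Canonical gwa_equiv := EquivRelPack gwa_relb_equiv.
Canonical gwa_encModRel := defaultEncModRel gwa_relb.

(* [a_central] is an argument so that the ring structure, whose carrier  *)
(* must be nonzero, can be attached to the type.                         *)
Definition gwa of (forall r : R, a * r = r * a) : Type := {eq_quot gwa_relb}.

Local Notation A := (gwa a_central).

HB.instance Definition _ := EqQuotient.on A.
HB.instance Definition _ := Choice.on A.

Definition gwa_pi (t : gwa_term R) : A := \pi_A (t : gwa_carrier).

Lemma gwa_piP t u : gwa_rel sigma a t u <-> gwa_pi t = gwa_pi u.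
Proof.
split=> [tu|/eqmodP/asboolP //].
by apply/eqmodP/asboolP.
Qed.

Definition gwa_repr (u : A) : gwa_term R := repr u.

Lemma gwa_reprK u : gwa_pi (gwa_repr u) = u.
Proof. exact: reprK. Qed.

Lemma gwa_reprP t : gwa_rel sigma a (gwa_repr (gwa_pi t)) t.
Proof. by apply/gwa_piP; rewrite gwa_reprK. Qed.

Lemma gwaW (P : A -> Prop) : (forall t, P (gwa_pi t)) -> forall u, P u.
Proof. by move=> H u; rewrite -(gwa_reprK u). Qed.

Definition gadd (u v : A) : A := gwa_pi (Add (gwa_repr u) (gwa_repr v)).
Definition gopp (u : A) : A := gwa_pi (Opp (gwa_repr u)).
Definition gmul (u v : A) : A := gwa_pi (Mul (gwa_repr u) (gwa_repr v)).
Definition gwa_coef (r : R) : A := gwa_pi (Coef r).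
Definition gwa_x : A := gwa_pi GenX.
Definition gwa_y : A := gwa_pi GenY.

Lemma gaddE t u : gadd (gwa_pi t) (gwa_pi u) = gwa_pi (Add t u).
Proof. by apply/gwa_piP/Gadd; apply: gwa_reprP. Qed.
Lemma goppE t : gopp (gwa_pi t) = gwa_pi (Opp t).
Proof. by apply/gwa_piP/Gopp; apply: gwa_reprP. Qed.
Lemma gmulE t u : gmul (gwa_pi t) (gwa_pi u) = gwa_pi (Mul t u).
Proof. by apply/gwa_piP/Gmul; apply: gwa_reprP. Qed.

Lemma gaddA : associative gadd.
Proof.
move=> u v w; elim/gwaW: u => t; elim/gwaW: v => t'; elim/gwaW: w => t''.
by rewrite !gaddE; apply/gwa_piP/GaddA.
Qed.
Lemma gaddC : commutative gadd.
Proof.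
move=> u v; elim/gwaW: u => t; elim/gwaW: v => t'.
by rewrite !gaddE; apply/gwa_piP/GaddC.
Qed.
Lemma gadd0 : left_id (gwa_coef 0) gadd.
Proof. by move=> u; elim/gwaW: u => t; rewrite gaddE; apply/gwa_piP/Gadd0. Qed.
Lemma gaddN : left_inverse (gwa_coef 0) gopp gadd.
Proof.
by move=> u; elim/gwaW: u => t; rewrite goppE gaddE; apply/gwa_piP/GaddN.
Qed.
Lemma gmulA : associative gmul.
Proof.
move=> u v w; elim/gwaW: u => t; elim/gwaW: v => t'; elim/gwaW: w => t''.
by rewrite !gmulE; apply/gwa_piP/GmulA.
Qed.
Lemma gmul1l : left_id (gwa_coef 1) gmul.
Proof. by move=> u; elim/gwaW: u => t; rewrite gmulE; apply/gwa_piP/Gmul1l. Qed.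
Lemma gmul1r : right_id (gwa_coef 1) gmul.
Proof. by move=> u; elim/gwaW: u => t; rewrite gmulE; apply/gwa_piP/Gmul1r. Qed.
Lemma gmulDl : left_distributive gmul gadd.
Proof.
move=> u v w; elim/gwaW: u => t; elim/gwaW: v => t'; elim/gwaW: w => t''.
by rewrite gaddE !gmulE gaddE; apply/gwa_piP/GmulDl.
Qed.
Lemma gmulDr : right_distributive gmul gadd.
Proof.
move=> u v w; elim/gwaW: u => t; elim/gwaW: v => t'; elim/gwaW: w => t''.
by rewrite gaddE !gmulE gaddE; apply/gwa_piP/GmulDr.
Qed.
Lemma gone_neq0 : gwa_coef 1 != gwa_coef 0.
Proof. by apply/eqP => /gwa_piP; apply: gwa_rel_neq. Qed.

HB.instance Definition _ := GRing.isZmodule.Build A gaddA gaddC gadd0 gaddN.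
HB.instance Definition _ := GRing.Zmodule_isNzRing.Build A
  gmulA gmul1l gmul1r gmulDl gmulDr gone_neq0.

Lemma gwa_coefD r s : gwa_coef (r + s) = gwa_coef r + gwa_coef s.
Proof. by rewrite [RHS]gaddE; apply/gwa_piP/GcoefD. Qed.
Lemma gwa_coefM r s : gwa_coef (r * s) = gwa_coef r * gwa_coef s.
Proof. by rewrite [RHS]gmulE; apply/gwa_piP/GcoefM. Qed.
Lemma gwa_yx : gwa_y * gwa_x = gwa_coef a.
Proof. by rewrite [LHS]gmulE; apply/gwa_piP/Gyx. Qed.
Lemma gwa_xy : gwa_x * gwa_y = gwa_coef (sigma a).
Proof. by rewrite [LHS]gmulE; apply/gwa_piP/Gxy. Qed.
Lemma gwa_xr r : gwa_x * gwa_coef r = gwa_coef (sigma r) * gwa_x.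
Proof. by rewrite [LHS]gmulE [RHS]gmulE; apply/gwa_piP/Gxr. Qed.
Lemma gwa_yr r : gwa_y * gwa_coef r = gwa_coef (sigmaV r) * gwa_y.
Proof. by rewrite [LHS]gmulE [RHS]gmulE; apply/gwa_piP/Gyr. Qed.

Lemma gwa_ind (P : A -> Prop) :
  (forall r, P (gwa_coef r)) -> P gwa_x -> P gwa_y ->
  (forall u, P u -> P (- u)) ->
  (forall u v, P u -> P v -> P (u + v)) ->
  (forall u v, P u -> P v -> P (u * v)) ->
  forall u, P u.
Proof.
move=> Pr Px Py PN PD PM u; elim/gwaW: u; elim=> // [t IH|t IHt u IHu|t IHt u IHu].
- by rewrite -goppE; apply: PN.
- by rewrite -gaddE; apply: PD.
- by rewrite -gmulE; apply: PM.
Qed.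

Definition gscale (c : K) (u : A) : A := gwa_coef c%:A * u.

Lemma gscalar_central c (u : A) : gwa_coef c%:A * u = u * gwa_coef c%:A.
Proof.
elim/gwa_ind: u => [r|||u IH|u v IHu IHv|u v IHu IHv].
- by rewrite -!gwa_coefM -scalerAl -scalerAr mul1r mulr1.
- by rewrite gwa_xr linearZ /= rmorph1.
- have sVc : sigmaV c%:A = c%:A by rewrite -[RHS](aut_funK sigma) linearZ /= rmorph1.
  by rewrite gwa_yr sVc.
- by rewrite mulrN IH mulNr.
- by rewrite mulrDr IHu IHv mulrDl.
- by rewrite mulrA IHu -mulrA IHv mulrA.
Qed.

Lemma gscaleA b c (u : A) : gscale b (gscale c u) = gscale (b * c) u.
Proof. by rewrite /gscale mulrA -gwa_coefM -scalerAl mul1r scalerA. Qed.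
Lemma gscale1 : left_id 1 gscale.
Proof. by move=> u; rewrite /gscale scale1r mul1r. Qed.
Lemma gscaleDr : right_distributive gscale +%R.
Proof. by move=> c u v; rewrite /gscale mulrDr. Qed.
Lemma gscaleDl (u : A) : {morph gscale^~ u : b c / b + c}.
Proof. by move=> b c; rewrite /gscale scalerDl gwa_coefD mulrDl. Qed.

HB.instance Definition _ := GRing.Zmodule_isLmodule.Build K A
  gscaleA gscale1 gscaleDr gscaleDl.

Lemma gscaleAl (c : K) (u v : A) : c *: (u * v) = c *: u * v.
Proof. by rewrite -[LHS]/(gscale c _) /gscale mulrA. Qed.
HB.instance Definition _ := GRing.Lmodule_isLalgebra.Build K A gscaleAl.

Lemma gscaleAr (c : K) (u v : A) : c *: (u * v) = u * (c *: v).
Proof.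
rewrite -[LHS]/(gscale c _) -[c *: v]/(gscale c v) /gscale mulrA.
by rewrite gscalar_central mulrA.
Qed.
HB.instance Definition _ := GRing.Lalgebra_isAlgebra.Build K A gscaleAr.

Lemma gwa_coef_linear : linear gwa_coef.
Proof.
move=> c r s; rewrite gwa_coefD -[c *: gwa_coef r]/(gscale c _) /gscale.
by rewrite -gwa_coefM -scalerAl mul1r.
Qed.
Lemma gwa_coef_monoid : monoid_morphism gwa_coef.
Proof. by split=> // r s; rewrite gwa_coefM. Qed.
HB.instance Definition _ := GRing.isLinear.Build K R A _ gwa_coef gwa_coef_linear.
HB.instance Definition _ := GRing.isMonoidMorphism.Build R A gwa_coef gwa_coef_monoid.

Section UniversalProperty.
Variables (B : algType K) (phi : {lrmorphism R -> B}) (x y : B).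
Hypothesis yx : y * x = phi a.
Hypothesis xy : x * y = phi (sigma a).
Hypothesis xr : forall r, x * phi r = phi (sigma r) * x.
Hypothesis yr : forall r, y * phi r = phi (sigmaV r) * y.

Fixpoint gwa_eval (t : gwa_term R) : B :=
  match t with
  | Coef r => phi r
  | GenX => x
  | GenY => y
  | Opp u => - gwa_eval u
  | Add u v => gwa_eval u + gwa_eval v
  | Mul u v => gwa_eval u * gwa_eval v
  end.

Lemma gwa_eval_rel t u : gwa_rel sigma a t u -> gwa_eval t = gwa_eval u.
Proof.
elim=> {t u} //=.
- by move=> t u v _ -> _ ->.
- by move=> t t' _ ->.
- by move=> t t' u u' _ -> _ ->.
- by move=> t t' u u' _ -> _ ->.
- by move=> *; rewrite addrA.
- by move=> *; rewrite addrC.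
- by move=> t; rewrite rmorph0 add0r.
- by move=> t; rewrite rmorph0 addNr.
- by move=> *; rewrite mulrA.
- by move=> t; rewrite rmorph1 mul1r.
- by move=> t; rewrite rmorph1 mulr1.
- by move=> *; rewrite mulrDl.
- by move=> *; rewrite mulrDr.
- by move=> *; rewrite rmorphD.
- by move=> *; rewrite rmorphM.
Qed.

Definition gwa_lift (u : A) : B := gwa_eval (gwa_repr u).

Lemma gwa_liftE t : gwa_lift (gwa_pi t) = gwa_eval t.
Proof. exact/gwa_eval_rel/gwa_reprP. Qed.

Lemma gwa_liftM : monoid_morphism gwa_lift.
Proof.
split=> [|u v]; first by rewrite [LHS]gwa_liftE /= rmorph1.
elim/gwaW: u => t; elim/gwaW: v => t'.
by rewrite [_ * _]gmulE !gwa_liftE.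
Qed.

Lemma gwa_lift_linear : linear gwa_lift.
Proof.
move=> c u v; elim/gwaW: u => t; elim/gwaW: v => t'.
rewrite -[c *: _]/(gscale c _) /gscale [_ * _]gmulE [_ + _]gaddE !gwa_liftE /=.
by rewrite linearZ /= rmorph1 -scalerAl mul1r.
Qed.

HB.instance Definition _ := GRing.isLinear.Build K A B _ gwa_lift gwa_lift_linear.
HB.instance Definition _ := GRing.isMonoidMorphism.Build A B gwa_lift gwa_liftM.

Lemma gwa_universal : exists f : {lrmorphism A -> B},
  [/\ forall r, f (gwa_coef r) = phi r, f gwa_x = x, f gwa_y = y &
      forall g : {lrmorphism A -> B}, (forall r, g (gwa_coef r) = phi r) ->
        g gwa_x = x -> g gwa_y = y -> g =1 f].
Proof.
exists gwa_lift; split=> [r|||g gr gx gy u].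
- by rewrite [LHS]gwa_liftE.
- by rewrite [LHS]gwa_liftE.
- by rewrite [LHS]gwa_liftE.
elim/gwa_ind: u => [r|||u IH|u v IHu IHv|u v IHu IHv].
- by rewrite gr [RHS]gwa_liftE.
- by rewrite gx [RHS]gwa_liftE.
- by rewrite gy [RHS]gwa_liftE.
- by rewrite [LHS]rmorphN [RHS]rmorphN /= IH.
- by rewrite [LHS]rmorphD [RHS]rmorphD /= IHu IHv.
- by rewrite [LHS]rmorphM [RHS]rmorphM /= IHu IHv.
Qed.

End UniversalProperty.

End GWAQuotient.

Arguments gwa {K R} sigma a a_central.
Arguments gwa_coef {K R sigma a a_central} r.
Arguments gwa_x {K R sigma a a_central}.
Arguments gwa_y {K R sigma a a_central}.

(* -------------------------------------------------------------------- *)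

Section Derivations.
Variables (K : comNzRingType) (A : algType K).

Definition derivation (D : A -> A) : Prop :=
  linear D /\ forall u v, D (u * v) = D u * v + u * D v.

Definition derivation_pred : {pred A -> A} := fun D => `[< derivation D >].

Lemma derivation_submod : submod_closed derivation_pred.
Proof.
split.
  apply/asboolP; split=> [c u v|u v]; rewrite /GRing.zero /=.
    by rewrite scaler0 addr0.
  by rewrite mul0r mulr0 addr0.
move=> c D E /asboolP[Dl DM] /asboolP[El EM]; apply/asboolP; split.
  move=> b u v; rewrite !fctE Dl El !scalerDr !scalerA [c * b]mulrC.
  by rewrite addrACA.
move=> u v; rewrite !fctE DM EM scalerDr !mulrDl !mulrDr scalerAl scalerAr.
by rewrite addrACA.
Qed.
HB.instance Definition _ :=
  GRing.isSubmodClosed.Build K (A -> A) derivation_pred derivation_submod.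

Record der : Type := Der {der_fun :> A -> A; _ : der_fun \in derivation_pred}.
HB.instance Definition _ := [isSub for der_fun].
HB.instance Definition _ := [Choice of der by <:].
HB.instance Definition _ := [SubChoice_isSubLmodule of der by <:].

Lemma derP (D : der) : derivation D.
Proof. by case: D => D /= /asboolP. Qed.

Lemma der_eqP (D E : der) : D =1 E <-> D = E.
Proof. by split=> [DE|-> //]; apply/val_inj/funext. Qed.

Definition ad_fun (t u : A) : A := t * u - u * t.

Lemma ad_derivation t : ad_fun t \in derivation_pred.
Proof.
apply/asboolP; split=> [c u v|u v]; rewrite /ad_fun.
  by rewrite mulrDr mulrDl -scalerAl -scalerAr scalerBr opprD addrACA.
by rewrite mulrBl mulrBr !mulrA addrA subrK.
Qed.

Definition ad (t : A) : der := Der (ad_derivation t).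

Definition inner_pred : {pred der} := fun D => `[< exists t, D = ad t >].

Lemma inner_submod : submod_closed inner_pred.
Proof.
split.
  apply/asboolP; exists 0; apply/der_eqP => u.
  by rewrite /= /ad_fun mul0r mulr0 subrr.
move=> c D E /asboolP[s ->] /asboolP[t ->]; apply/asboolP.
exists (c *: s + t); apply/der_eqP => u.
rewrite /= !fctE /= /ad_fun mulrDl mulrDr -scalerAl -scalerAr scalerBr.
by rewrite opprD addrACA.
Qed.
HB.instance Definition _ :=
  GRing.isSubmodClosed.Build K der inner_pred inner_submod.

Definition HH1 : Type := Quotient.quot inner_pred.
HB.instance Definition _ := GRing.Zmodule.on HH1.
HB.instance Definition _ := EqQuotient.on HH1.

Definition HH1_class (D : der) : HH1 := \pi_HH1 D.
Definition HH1_scale (c : K) (w : HH1) : HH1 := HH1_class (c *: repr w).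

Lemma HH1_classE D E : (HH1_class D == HH1_class E) = (D - E \in inner_pred).
Proof. by rewrite Quotient.idealrBE. Qed.

Lemma HH1_classP D E : HH1_class D = HH1_class E <-> exists t, D - E = ad t.
Proof.
split=> [/eqP|H]; first by rewrite HH1_classE => /asboolP.
by apply/eqP; rewrite HH1_classE; apply/asboolP.
Qed.

Lemma HH1_classD D E : HH1_class (D + E) = HH1_class D + HH1_class E.
Proof. exact: pi_addr. Qed.

Lemma HH1_scaleE c D : HH1_scale c (HH1_class D) = HH1_class (c *: D).
Proof.
apply/eqP; rewrite HH1_classE -scalerBr; apply: rpredZ.
by rewrite -HH1_classE /HH1_class reprK.
Qed.

Lemma HH1W (P : HH1 -> Prop) : (forall D, P (HH1_class D)) -> forall w, P w.
Proof. by move=> H w; rewrite -[w]reprK. Qed.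

Lemma HH1_scaleA b c w : HH1_scale b (HH1_scale c w) = HH1_scale (b * c) w.
Proof. by elim/HH1W: w => D; rewrite !HH1_scaleE scalerA. Qed.
Lemma HH1_scale1 : left_id 1 HH1_scale.
Proof. by move=> w; elim/HH1W: w => D; rewrite HH1_scaleE scale1r. Qed.
Lemma HH1_scaleDr : right_distributive HH1_scale +%R.
Proof.
move=> c w w'; elim/HH1W: w => D; elim/HH1W: w' => E.
by rewrite -HH1_classD !HH1_scaleE scalerDr HH1_classD.
Qed.
Lemma HH1_scaleDl w : {morph HH1_scale^~ w : b c / b + c}.
Proof.
by move=> b c; elim/HH1W: w => D; rewrite !HH1_scaleE scalerDl HH1_classD.
Qed.
HB.instance Definition _ := GRing.Zmodule_isLmodule.Build K HH1
  HH1_scaleA HH1_scale1 HH1_scaleDr HH1_scaleDl.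

End Derivations.

(* [is_delta alpha D]: D is the derivation delta_alpha of a generalized  *)
(* Weyl algebra over K[h^{+-1}].                                         *)
Definition is_delta (K : comNzRingType) (sigma : alg_aut (laurent K))
    (a : laurent K) (ca : forall r, a * r = r * a)
    (alpha : K) (D : der (gwa sigma a ca)) : Prop :=
  [/\ D (gwa_coef (lvar K)) = 0,
      D gwa_x = alpha *: gwa_x &
      D gwa_y = - (alpha *: gwa_y)].

(* Main.v *)
(** Let R = K[h^{+-1}].  Letting A act on sequences in R shows that A is free over R on
    the elements [gmon n], the powers of x and y, and [gmon n] has weight q^n under
    conjugation by h.  Let D be a derivation.  As q is not a root of unity, an inner
    derivation removes all components of D(h) of nonzero degree, so D(h) may be assumed
    to lie in R.  Applying D to xh = qhx and yh = q^-1 hy then gives D(h) = ch,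
    D(x) = fx, D(y) = gy with f, g in R.  Applying D to yx = a gives c h a' = w a for
    w = g + sigma^-1(f).  Comparing extreme degrees shows that w is a constant, and
    c <> 0 would force all exponents of a to agree in K, which is excluded; hence
    c = w = 0.  Finally f = s - sigma(s) + f_0, so that D = ad_s + delta_(f_0).  If
    delta_alpha is some ad_t, then t lies in R because it commutes with h, and alpha is
    the constant coefficient of t - sigma(t), that is 0. *)

Require Import Defs.
From HB Require Import structures.
From mathcomp Require Import all_boot all_order all_algebra.
From mathcomp Require Import finmap boolp monalg zify ring.

Set Implicit Arguments.
Unset Strict Implicit.
Unset Printing Implicit Defensive.

Import Order.TTheory GRing.Theory Num.Theory.
Local Open Scope ring_scope.

(** * Coefficients and extreme degrees of Laurent polynomials *)

Section LaurentRing.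
Variable K : comNzRingType.
Implicit Types (f g : laurent K) (i j k s : int).

Lemma lmonoE (c : K) i j : (lmono c i)@_j = c *+ (i == j).
Proof. exact: mcoeffU. Qed.

Lemma lmono1 : lmono (1 : K) 0 = 1.
Proof. by []. Qed.

Lemma lscale_mono (c d : K) i : c *: lmono d i = lmono (c * d) i.
Proof. by apply/malgP => j; rewrite mcoeffZ !lmonoE mulrnAr. Qed.

Lemma lcoefM f g k : (f * g)@_k = \sum_(i <- msupp f) f@_i * g@_(k - i).
Proof.
rewrite -[f * g]/(lmul f g) /lmul /lext raddf_sum; apply: eq_bigr => i _ /=.
rewrite mcoeffZ; congr (_ * _).
rewrite [in RHS](monalgE g) !raddf_sum; apply: eq_bigr => j _ /=.
rewrite mcoeffZ !mcoeffU mulr_natr; congr (_ *+ (_ : bool)).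
by apply/eqP/eqP; lia.
Qed.

Lemma lmonoME (c : K) i f k : (lmono c i * f)@_k = c * f@_(k - i).
Proof.
have [->|c0] := eqVneq c 0; first by rewrite /lmono monalgU0 mul0r mcoeff0 mul0r.
rewrite lcoefM /lmono msuppU (negbTE c0).
by rewrite big_seq_fset1 mcoeffUU.
Qed.

Lemma laurent_ind (P : laurent K -> Prop) :
  P 0 -> (forall f g, P f -> P g -> P (f + g)) ->
  (forall c i, P (lmono c i)) -> forall f, P f.
Proof.
move=> P0 PD PU f; rewrite [f]monalgE.
by apply: big_ind => // i _; exact: PU.
Qed.

Lemma lmono_lvar i : lvar K * lmono 1 i = lmono 1 (i + 1).
Proof. by rewrite lmonoM mulr1 addrC. Qed.

Lemma lvarI : injective ( *%R (lvar K)).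
Proof.
move=> f g /(congr1 ( *%R (lmono 1 (-1)))).
by rewrite !mulrA lmonoM mulr1 addNr lmono1 !mul1r.
Qed.

(* With [s = 1] or [s = -1], this is a nonzero term of highest or of lowest degree. *)
Definition extremal s f m :=
  f@_m != 0 /\ forall i, f@_i != 0 -> s * i <= s * m.

Lemma extremal_ex s f : f != 0 -> exists m, extremal s f m.
Proof.
move=> f0; have [i fi] : exists i, f@_i != 0.
  apply: contrapT => H; move/eqP: f0; apply; apply/malgP => i.
  by rewrite mcoeff0; apply/eqP; apply: contrapT => /negP fi; apply: H; exists i.
have iin : i \in msupp f by rewrite -mcoeff_neq0.
pose i0 : msupp f := [` iin]%fset.
case: (@arg_maxP _ _ _ i0 predT (fun j : msupp f => s * val j)) => // m _ mmax.
exists (val m); split=> [|j fj]; first by rewrite mcoeff_neq0 (valP m).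
have jin : j \in msupp f by rewrite -mcoeff_neq0.
by have := mmax [` jin]%fset isT.
Qed.

(** If h^i from [f] meets h^(m + n - i) from [g], the two bounds give s i = s m, hence i = m as [s]
    is nonzero: no other pair reaches this degree. *)
Lemma extremalM s f g m n : s != 0 -> extremal s f m -> extremal s g n ->
  (f * g)@_(m + n) = f@_m * g@_n.
Proof.
move=> s0 [fm fmax] [gn gmax].
have mf : m \in msupp f by rewrite -mcoeff_neq0.
rewrite lcoefM (big_fsetD1 m) //= [m + n - m]addrC addKr big1_fset ?addr0 //.
move=> i; rewrite !inE -mcoeff_neq0 => /andP[im fi] _.
have [gi|gi] := eqVneq g@_(m + n - i) 0; first by rewrite gi mulr0.
have := fmax _ fi; have := gmax _ gi; rewrite mulrBr mulrDr => le1 le2.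
have /eqP : s * i = s * m by lia.
by rewrite (inj_eq (mulfI s0)) (negbTE im).
Qed.

(** Covers both the Euler operator and, away from degree 0, the inverse of 1 - [sigma]. *)
Definition diag (c : int -> K) f : laurent K := lext (fun i => lmono (c i) i) f.

Lemma diagE c f k : (diag c f)@_k = c k * f@_k.
Proof.
elim/laurent_ind: f => [|f g IHf IHg|b i].
- by rewrite /diag linear0 !mcoeff0 mulr0.
- by rewrite /diag linearD !mcoeffD IHf IHg mulrDr.
- rewrite /diag lextU mcoeffZ !lmonoE.
  by case: eqP => [->|_]; rewrite ?mulr0n ?mulr0 // !mulr1n mulrC.
Qed.

End LaurentRing.

(** * Absence of zero divisors, and multipliers that preserve a support *)

Section LaurentField.
Variable K : fieldType.
Implicit Types (f g w : laurent K) (i j k : int).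

Lemma lmulf_neq0 f g : f != 0 -> g != 0 -> f * g != 0.
Proof.
move=> /(extremal_ex 1)[m fm] /(extremal_ex 1)[n gn].
apply/eqP => /(congr1 (mcoeff (m + n))); rewrite (extremalM _ fm gn) // mcoeff0.
by apply/eqP; rewrite mulf_neq0; [|case: fm|case: gn].
Qed.

Lemma lmulf_eq0l f g : g != 0 -> f * g = 0 -> f = 0.
Proof.
move=> g0 fg; apply/eqP; apply: contraT => f0.
by have := lmulf_neq0 f0 g0; rewrite fg eqxx.
Qed.

(* Multiplying by [f] moves the extreme degrees of [g] by those of [f]. *)
Lemma supp_mul_const f g : g != 0 ->
  (forall k, (f * g)@_k != 0 -> g@_k != 0) -> f = lmono f@_0 0.
Proof.
move=> g0 fg; have [->|f0] := eqVneq f 0; first by rewrite mcoeff0 /lmono monalgU0.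
(* The [s]-extreme terms of [f] and [g] multiply to a nonzero term of degree m + n, which lies in
   the support of [g]; extremality of n then forces s m <= 0. The two signs of [s] together leave
   only degree 0. *)
have le0 s : s != 0 -> forall i, f@_i != 0 -> s * i <= 0.
  move=> s0 i fi; have [m [fm fmax]] := extremal_ex s f0.
  have [n [gn gmax]] := extremal_ex s g0.
  have /fg/gmax : (f * g)@_(m + n) != 0 by rewrite (@extremalM _ s) ?mulf_neq0.
  rewrite mulrDr gerDr; exact/le_trans/fmax.
apply/malgP => i; rewrite lmonoE.
case: eqP => [<-|/eqP i0] //; apply/eqP; apply: contraT => fi.
have := le0 1 isT i fi; have := le0 (-1) isT i fi; rewrite mul1r mulN1r; lia.
Qed.

End LaurentField.

(** * The action of [sigma] on coefficients *)

Section Sigma.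
Variables (K : fieldType) (q : K) (q_neq0 : q != 0).
Variables (sigma : alg_aut (laurent K)).
Hypothesis sigmaE : sigma (lvar K) = q *: lvar K.

Lemma sigma_mono c i : sigma (lmono c i) = lmono (q ^ i * c) i.
Proof.
have -> : lmono c i = c *: lmono 1 i by rewrite lscale_mono mulr1.
rewrite linearZ /= [q ^ i * c]mulrC -lscale_mono; congr (_ *: _).
(* An equivalence, so that the induction can move both up and down from exponent 0; moving down
   cancels [q] and h. *)
have step j : sigma (lmono 1 (j + 1)) = lmono (q ^ (j + 1)) (j + 1) <->
    sigma (lmono 1 j) = lmono (q ^ j) j.
  rewrite -lmono_lvar rmorphM /= sigmaE.
  have -> : lmono (q ^ (j + 1)) (j + 1) = q *: lvar K * lmono (q ^ j) j.
    by rewrite lscale_mono lmonoM mulr1 expfzDr // expr1z mulrC addrC.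
  split=> [|-> //]; rewrite -!scalerAl => /scalerI H.
  by apply/lvarI/H.
elim/int_ind: i => [|n /step|n IH].
- by rewrite expr0z rmorph1.
- by rewrite -PoszD addn1.
- apply/step; move: IH; rewrite (_ : - n.+1%:Z + 1 = - n%:Z) //; lia.
Qed.

Lemma sigmaC f k : (sigma f)@_k = q ^ k * f@_k.
Proof.
elim/laurent_ind: f => [|f g IHf IHg|c i].
- by rewrite linear0 !mcoeff0 mulr0.
- by rewrite linearD !mcoeffD IHf IHg mulrDr.
- by rewrite sigma_mono !lmonoE; case: eqP => [->|_]; rewrite ?mulr0.
Qed.
End Sigma.

(** * Freeness of the generalized Weyl algebra over its coefficient ring *)

Section Basis.
Variables (K : comNzRingType) (R : algType K) (sigma : alg_aut R) (a : R).
Variable (ca : forall r, a * r = r * a).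
Local Notation A := (gwa sigma a ca).
Local Notation coef := (@gwa_coef K R sigma a ca).
Implicit Types (u w : A) (r s : R) (f : int -> R) (n m k : int).

(** The basis element of degree [n]. [Negz m] stands for -(m + 1), whence the exponent [m.+1] of
    y. *)
Definition gmon n : A :=
  match n with Posz m => gwa_x ^+ m | Negz m => gwa_y ^+ m.+1 end.

Lemma gmonr n r : gmon n * coef r = coef (aut_pow sigma n r) * gmon n.
Proof.
have expr (z : A) (g : R -> R) : (forall s, z * coef s = coef (g s) * z) ->
    forall (m : nat) s, z ^+ m * coef s = coef (iter m g s) * z ^+ m.
  move=> zg; elim=> [|m IH] s; first by rewrite !expr0 mul1r mulr1.
  by rewrite exprS -mulrA IH mulrA zg -mulrA.
by case: n => m; apply: expr => s; [exact: gwa_xr | exact: gwa_yr].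
Qed.

Lemma mulx_gmon n : exists r, gwa_x * gmon n = coef r * gmon (n + 1).
Proof.
case: n => m; first by exists 1; rewrite rmorph1 mul1r -exprS -PoszD addn1.
exists (sigma a); rewrite /= exprS mulrA gwa_xy; congr (_ * _).
case: m => [|m]; first by rewrite expr0.
by have -> : Negz m.+1 + 1 = Negz m by lia.
Qed.

Lemma muly_gmon n : exists r, gwa_y * gmon n = coef r * gmon (n - 1).
Proof.
case: n => [[|m]|m].
- by exists 1; rewrite rmorph1 mul1r mulr1.
- exists a; have -> : Posz m.+1 - 1 = Posz m by lia.
  by rewrite /= exprS mulrA gwa_yx.
- exists 1; have -> : Negz m - 1 = Negz m.+1 by lia.
  by rewrite rmorph1 mul1r /= -exprS.
Qed.

(** The element with left coordinates [z] in the family [gmon]; freeness is the bijectivity of this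
    map. *)
Definition gexp (z : {malg R[int]}) : A := mmap coef gmon z.

Lemma gexpU r n : gexp << r *g n >> = coef r * gmon n.
Proof. exact: mmapU. Qed.

Lemma gexpE z : gexp z = \sum_(n <- msupp z) coef z@_n * gmon n.
Proof. exact: mmapE. Qed.

Lemma gexpD : {morph gexp : z w / z + w}.
Proof. exact: raddfD. Qed.

Lemma gexp_sum (I : Type) (l : seq I) (F : I -> {malg R[int]}) :
  gexp (\sum_(i <- l) F i) = \sum_(i <- l) gexp (F i).
Proof. exact: raddf_sum. Qed.

Definition gmap (F : int -> R -> R) (z : {malg R[int]}) : {malg R[int]} :=
  [malg n in msupp z => F n z@_n].

Lemma gmapE F z k : F k 0 = 0 -> (gmap F z)@_k = F k z@_k.
Proof.
by move=> F0; rewrite mcoeffE; case: ifPn => // /mcoeff_outdom ->.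
Qed.

Lemma gexp_gmap F z :
  gexp (gmap F z) = \sum_(n <- msupp z) coef (F n z@_n) * gmon n.
Proof.
rewrite /gexp (mmapEw (d := msupp z)); last first.
  apply/fsubsetP => k; rewrite -mcoeff_neq0 mcoeffE.
  by case: ifP => //; rewrite eqxx.
by apply: eq_big_seq => n nz; rewrite mcoeffE nz.
Qed.

Lemma coefM_gexp r z : coef r * gexp z = gexp (gmap (fun _ s => r * s) z).
Proof.
rewrite gexp_gmap gexpE mulr_sumr; apply: eq_bigr => n _.
by rewrite rmorphM mulrA.
Qed.

Lemma gexpM_coef r z :
  gexp z * coef r = gexp (gmap (fun n s => s * aut_pow sigma n r) z).
Proof.
rewrite gexp_gmap gexpE mulr_suml; apply: eq_bigr => n _.
by rewrite rmorphM -!mulrA gmonr.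
Qed.

(** The left span of the [gmon n] contains 1 and is stable under left multiplication by
    coefficients, x and y, hence by every [u]. *)
Lemma gexp_surj u : exists z, u = gexp z.
Proof.
suff [z zE] : exists z, u * gexp << 1 *g 0 >> = gexp z.
  by exists z; rewrite -zE gexpU rmorph1 !mulr1.
(* Every expansion is allowed in place of 1, so that the induction passes through products. *)
move: << 1 *g 0 >>.
have gen w : (forall n r, exists z, w * (coef r * gmon n) = gexp z) ->
    forall z, exists z', w * gexp z = gexp z'.
  move=> wU z; have [F FE] := choice (fun n => wU n z@_n).
  exists (\sum_(n <- msupp z) F n).
  rewrite gexp_sum gexpE mulr_sumr; exact: eq_bigr.
elim/gwa_ind: u => [s|||u IH|u w IHu IHw|u w IHu IHw] z.
- apply: gen => n r; exists << s * r *g n >>.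
  by rewrite gexpU rmorphM mulrA.
- apply: gen => n r; have [s sE] := mulx_gmon n.
  exists << sigma r * s *g n + 1 >>.
  by rewrite gexpU rmorphM mulrA gwa_xr -!mulrA sE.
- apply: gen => n r; have [s sE] := muly_gmon n.
  exists << aut_inv sigma r * s *g n - 1 >>.
  by rewrite gexpU rmorphM mulrA gwa_yr -!mulrA sE.
- by have [z' E] := IH z; exists (- z'); rewrite mulNr E /gexp raddfN.
- have [zu Eu] := IHu z; have [zw Ew] := IHw z; exists (zu + zw).
  by rewrite mulrDl Eu Ew gexpD.
- have [zw Ew] := IHw z; have [zu Eu] := IHu zw; exists zu.
  by rewrite -mulrA Ew.
Qed.

Definition act u : (int -> R) -> int -> R := gwa_act sigma a (gwa_repr u).

Lemma act_pi (t : gwa_term R) : act (gwa_pi sigma ca t) = gwa_act sigma a t.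
Proof. exact/gwa_act_rel/gwa_reprP. Qed.

Lemma actD u w f n : act (u + w) f n = act u f n + act w f n.
Proof. by rewrite -[u + w]/(gadd _ _) /gadd act_pi. Qed.

Lemma actM u w f : act (u * w) f = act u (act w f).
Proof. by rewrite -[u * w]/(gmul _ _) /gmul act_pi. Qed.

Lemma act_coef r f n : act (coef r) f n = aut_pow sigma n r * f n.
Proof. by rewrite act_pi. Qed.

Lemma act_sum (I : Type) (l : seq I) (F : I -> A) f n :
  act (\sum_(i <- l) F i) f n = \sum_(i <- l) act (F i) f n.
Proof.
elim: l => [|i l IH]; last by rewrite !big_cons actD IH.
by rewrite !big_nil -(rmorph0 coef) act_coef aut_pow0 mul0r.
Qed.

Hypothesis a_reg : forall r, r * a = 0 -> r = 0.

Lemma aut_pow_eq0 n r : aut_pow sigma n r = 0 -> r = 0.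
Proof.
have V0 s : aut_inv sigma s = 0 -> s = 0.
  by move=> s0; rewrite -(aut_invK sigma s) s0 rmorph0.
have S0 s : sigma s = 0 -> s = 0.
  by move=> s0; rewrite -(aut_funK sigma s) s0 -{1}(rmorph0 sigma) aut_funK.
by case: n => m /=; [|move/V0]; elim: m => //= m IH; [move/S0|move/V0].
Qed.

(** The twist is bijective and multiplicative, so regularity passes from [a] to its image. *)
Lemma mul_aut_pow_reg n r : r * aut_pow sigma n a = 0 -> r = 0.
Proof.
have [s <-] : exists s, aut_pow sigma n s = r.
  have surj (f g : R -> R) : cancel g f ->
      forall (m : nat) t, exists s, iter m f s = t.
    move=> gK; elim=> [|m IH] t; first by exists t.
    by have [s <-] := IH t; exists (g s); rewrite iterSr gK.
  by case: n => m; apply: surj; [exact: aut_invK | exact: aut_funK].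
by rewrite -aut_powM => /aut_pow_eq0/a_reg ->; rewrite aut_pow0.
Qed.

(** Up to a factor, [gmon n] is the shift by [n]. The factor is 1 for powers of x and a product of
    twists of [a] for powers of y. *)
Lemma act_gmon n m : exists p, (forall r, r * p = 0 -> r = 0) /\
  forall f, act (gmon n) f m = p * f (m + n).
Proof.
case: n => n /=.
  exists 1; split=> [r|f]; first by rewrite mulr1.
  rewrite mul1r; elim: n m => [|n IH] m.
    by rewrite expr0 -(rmorph1 coef) act_coef aut_pow1 mul1r addr0.
  by rewrite exprS actM act_pi /= IH; congr f; lia.
elim: n m => [|n IH] m.
  exists (aut_pow sigma m a); split=> [r|f]; last by rewrite expr1 act_pi.
  exact: mul_aut_pow_reg.
have [p [preg pE]] := IH (m - 1).
exists (aut_pow sigma m a * p); split=> [r|f].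
  by rewrite mulrA => /preg/mul_aut_pow_reg.
by rewrite exprS actM act_pi /= pE mulrA; congr (_ * f _); lia.
Qed.

(** Acting on the indicator sequence of [k] and reading off the value at 0 isolates the coordinate
    of degree [k], up to a regular factor. *)
Lemma gexp_inj : injective gexp.
Proof.
apply: raddf_inj => z /(id : _ -> gexp z = 0) z0; apply/malgP => k; rewrite mcoeff0.
have [p [preg pE]] := act_gmon k 0.
apply: preg; have := act_sum (msupp z) (fun n => coef z@_n * gmon n)
  (fun m => (m == k)%:R) 0.
rewrite -gexpE z0 -(rmorph0 coef) act_coef aut_pow0 mul0r => /esym.
pose G n := if n == k then z@_k * p else 0.
rewrite (eq_bigr G) => [|n _]; last first.
  rewrite actM act_coef /= /G; case: eqP => [->|/eqP nk].
    by rewrite pE add0r eqxx mulr1.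
  by have [p' [_ ->]] := act_gmon n 0; rewrite add0r (negbTE nk) !mulr0.
rewrite -big_mkcond /=; have [kz|kz] := boolP (k \in msupp z).
  rewrite -big_filter (@filter_pred1_uniq _ (enum_fset (msupp z)) k) //.
  by rewrite big_seq1.
by rewrite (mcoeff_outdom kz) mul0r.
Qed.

Lemma coef_inj : injective coef.
Proof.
move=> r s rs; have : gexp << r *g 0 >> = gexp << s *g 0 >> by rewrite !gexpU rs.
by move=> /gexp_inj/(congr1 (mcoeff 0)); rewrite !mcoeffUU.
Qed.

Lemma coef_gmon_inj n : injective (fun r => coef r * gmon n).
Proof.
move=> r s /=; rewrite -!gexpU => /gexp_inj/(congr1 (mcoeff n)).
by rewrite !mcoeffUU.
Qed.

End Basis.

(** * Existence of delta_alpha *)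

Section GradingDerivation.
Variables (K : comNzRingType) (R : algType K) (sigma : alg_aut R) (a : R).
Variable (ca : forall r, a * r = r * a).
Local Notation A := (gwa sigma a ca).
Local Notation coef := (@gwa_coef K R sigma a ca).
Local Notation pi := (gwa_pi sigma ca).
Variable alpha : K.

(** The Leibniz rule is taken as the definition on expressions, and then shown to respect the
    defining congruence. *)
Fixpoint grading_term (t : gwa_term R) : A :=
  match t with
  | Coef _ => 0
  | GenX => alpha *: gwa_x
  | GenY => - (alpha *: gwa_y)
  | Opp t => - grading_term t
  | Add t u => grading_term t + grading_term u
  | Mul t u => grading_term t * pi u + pi t * grading_term u
  end.

(** The relations for yx and xy survive because x and y carry opposite weights [alpha] and -[alpha],
    which cancel in the product. *)
Lemma grading_term_rel t u :
  gwa_rel sigma a t u -> grading_term t = grading_term u.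
Proof.
have piM t1 t2 : pi (Mul t1 t2) = pi t1 * pi t2 by rewrite [RHS]gmulE.
have piD t1 t2 : pi (Add t1 t2) = pi t1 + pi t2 by rewrite [RHS]gaddE.
elim=> {t u} //=.
- by move=> t u v _ -> _ ->.
- by move=> t u _ ->.
- by move=> t t' u u' _ -> _ ->.
- by move=> t t' u u' /(gwa_piP sigma ca) -> -> /(gwa_piP sigma ca) -> ->.
- by move=> *; rewrite addrA.
- by move=> *; rewrite addrC.
- by move=> *; rewrite add0r.
- by move=> *; rewrite addNr.
- by move=> t u v; rewrite !piM mulrDr mulrDl !mulrA addrA.
- by move=> t; rewrite mul0r mul1r add0r.
- by move=> t; rewrite mulr0 mulr1 addr0.
- by move=> t u v; rewrite piD !mulrDl addrACA.
- by move=> t u v; rewrite piD !mulrDr addrACA.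
- by move=> *; rewrite addr0.
- by move=> r s; rewrite mul0r mulr0 addr0.
- by rewrite mulNr -scalerAl -scalerAr addNr.
- by rewrite mulrN -scalerAl -scalerAr addrN.
- move=> r; rewrite mulr0 mul0r add0r addr0 -scalerAl -scalerAr.
  by rewrite [gwa_x * _]gwa_xr.
- move=> r; rewrite mulr0 mul0r add0r addr0 mulNr mulrN -scalerAl -scalerAr.
  by rewrite [gwa_y * _]gwa_yr.
Qed.

Definition grading_fun (u : A) : A := grading_term (gwa_repr u).

Lemma grading_pi t : grading_fun (pi t) = grading_term t.
Proof. exact/grading_term_rel/gwa_reprP. Qed.

Lemma grading_derivation : grading_fun \in @derivation_pred K A.
Proof.
have DM u v : grading_fun (u * v) = grading_fun u * v + u * grading_fun v.
  by rewrite -[u * v]/(gmul u v) /gmul grading_pi /= !gwa_reprK.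
apply/asboolP; split=> // c u v.
rewrite -[_ + _]/(gadd _ _) /gadd grading_pi /=; congr (_ + _).
(* A scalar acts as multiplication by a coefficient, which is killed, so homogeneity is a case of
   the Leibniz rule. *)
rewrite -/(grading_fun _) -[c *: u]/(coef c%:A * u) DM [grading_fun (coef _)]grading_pi.
by rewrite mul0r add0r.
Qed.

Definition grading_der : der A := Der grading_derivation.

Lemma grading_coef r : grading_der (coef r) = 0.
Proof. exact: grading_pi. Qed.

Lemma grading_x : grading_der gwa_x = alpha *: gwa_x.
Proof. exact: grading_pi. Qed.

Lemma grading_y : grading_der gwa_y = - (alpha *: gwa_y).
Proof. exact: grading_pi. Qed.

End GradingDerivation.

(** * Rules of calculus for derivations *)

Section DerivationTheory.
Variables (K : comNzRingType) (A : algType K).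
Implicit Types (D : der A) (u v : A).

Lemma derD D : {morph D : u v / u + v}.
Proof. by move=> u v; have [lin _] := derP D; rewrite -[u]scale1r lin !scale1r. Qed.

Lemma derZ D (c : K) u : D (c *: u) = c *: D u.
Proof.
have [lin _] := derP D; have D0 : D 0 = 0.
  by have := lin (-1) 0 0; rewrite scaler0 addr0 scaleN1r addNr.
by rewrite -[c *: u]addr0 lin D0 addr0.
Qed.

Lemma derM D u v : D (u * v) = D u * v + u * D v.
Proof. by have [_ ->] := derP D. Qed.

Lemma der1 D : D 1 = 0.
Proof.
by have := derM D 1 1; rewrite !mulr1 mul1r => /esym/(canRL (addKr _)); rewrite addNr.
Qed.

End DerivationTheory.

(** * Derivations are determined by their values on h, x and y *)

Section DerivationLaurent.
Variables (K : comNzRingType) (sigma : alg_aut (laurent K)) (a : laurent K).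
Local Notation R := (laurent K).
Local Notation A := (gwa sigma a (mulrC a)).
Local Notation coef := (@gwa_coef K R sigma a (mulrC a)).
Local Notation h := (lvar K).
Local Notation x := (@gwa_x K R sigma a (mulrC a)).
Local Notation y := (@gwa_y K R sigma a (mulrC a)).
Implicit Types (D E : der A) (r : R).

(** The operator h d/dh. *)
Definition euler r : R := diag (fun i => i%:~R) r.

Lemma der_coef D c : D (coef h) = c *: coef h ->
  forall r, D (coef r) = c *: coef (euler r).
Proof.
move=> Dh; have D0 : D 0 = 0 by have := derZ D 0 0; rewrite !scale0r.
elim/laurent_ind => [|r s IHr IHs|b i].
- by rewrite rmorph0 D0 /euler /diag linear0 rmorph0 scaler0.
- by rewrite rmorphD derD IHr IHs /euler /diag linearD rmorphD scalerDr.
have -> : lmono b i = b *: lmono 1 i by rewrite lscale_mono mulr1.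
rewrite /euler /diag !linearZ /= derZ; congr (_ *: _).
rewrite lextU scale1r; have -> : lmono i%:~R i = i%:~R *: lmono 1 i :> R.
  by rewrite lscale_mono mulr1.
(* The Leibniz rule for h h^j links consecutive exponents; the downward direction multiplies by
   h^-1. *)
have step j : D (coef (lmono 1 (j + 1))) = c *: coef ((j + 1)%:~R *: lmono 1 (j + 1)) <->
    D (coef (lmono 1 j)) = c *: coef (j%:~R *: lmono 1 j).
  have -> : D (coef (lmono 1 (j + 1))) =
      c *: coef (lmono 1 (j + 1)) + coef h * D (coef (lmono 1 j)).
    by rewrite -lmono_lvar rmorphM derM Dh -scalerAl.
  have -> : c *: coef ((j + 1)%:~R *: lmono 1 (j + 1)) = c *: coef (lmono 1 (j + 1)) +
      coef h * (c *: coef (j%:~R *: lmono 1 j)).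
    rewrite -scalerAr -rmorphM -scalerAr lmono_lvar -scalerDr -rmorphD.
    by rewrite intrD scalerDl scale1r [in RHS]addrC.
  split=> [/addrI/(congr1 ( *%R (coef (lmono 1 (-1)))))|-> //].
  by rewrite !mulrA -rmorphM /= lmonoM mulr1 addNr rmorph1 !mul1r.
elim/int_ind: i => [|n IH|n IH].
- by rewrite rmorph1 der1 scale0r rmorph0 scaler0.
- by have := (step n%:Z).2 IH; rewrite -PoszD addn1.
- apply: (step (- n.+1%:Z)).1; have -> : - n.+1%:Z + 1 = - n%:Z by lia.
  exact: IH.
Qed.

(** The difference kills h, hence all coefficients by [der_coef] with c = 0; the generators then
    determine the rest. *)
Lemma der_ext D E : D (coef h) = E (coef h) -> D x = E x -> D y = E y -> D = E.
Proof.
move=> Dh Dx Dy; apply/der_eqP.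
have sub u : (D - E) u = D u - E u by [].
have F0 r : D (coef r) = E (coef r).
  apply/eqP; rewrite -subr_eq0 -sub (@der_coef _ 0) ?scale0r //.
  by rewrite sub Dh subrr.
elim/gwa_ind => [//|//|//|u IH|u v IHu IHv|u v IHu IHv].
- by rewrite -scaleN1r !derZ IH.
- by rewrite !derD IHu IHv.
- by rewrite !derM IHu IHv.
Qed.

Lemma grading_is_delta alpha : is_delta alpha (grading_der sigma (mulrC a) alpha).
Proof. by split; rewrite ?grading_coef ?grading_x ?grading_y. Qed.

Lemma is_delta_uniq alpha D E : is_delta alpha D -> is_delta alpha E -> D = E.
Proof. by move=> [Dh Dx Dy] [Eh Ex Ey]; apply: der_ext; rewrite ?Eh ?Ex ?Ey. Qed.

End DerivationLaurent.

(** * Weights under conjugation by h when q is not a root of unity *)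

Section GWALaurent.
Variables (K : fieldType) (q : K) (q_neq0 : q != 0).
Hypothesis q_not_root : forall n : nat, (0 < n)%N -> q ^+ n != 1.
Variables (sigma : alg_aut (laurent K)).
Hypothesis sigmaE : sigma (lvar K) = q *: lvar K.
Local Notation R := (laurent K).
Local Notation h := (lvar K).
Implicit Types (r : R) (n k : int).

Let sigma_coef r k : (sigma r)@_k = q ^ k * r@_k.
Proof. exact: sigmaC. Qed.

Lemma expq_inj : injective (fun n : int => q ^ n).
Proof.
have expq1 n : q ^ n = 1 -> n = 0.
  case: n => [[//|n]|n]; first by move/eqP; rewrite (negbTE (q_not_root _)).
  move/eqP; rewrite NegzE -invr_expz invr_eq1 => /eqP/eqP.
  by rewrite (negbTE (q_not_root _)).
move=> m n /= mn; apply/eqP; rewrite -subr_eq0; apply/eqP/expq1.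
by rewrite expfzDr // mn -expfzDr // addrN.
Qed.

Lemma sigmaV_coef r k : (aut_inv sigma r)@_k = q ^ (- k) * r@_k.
Proof.
by rewrite -{2}[r](aut_invK sigma) sigma_coef mulrA -expfzDr // addNr mul1r.
Qed.

Lemma aut_pow_coef n r k : (aut_pow sigma n r)@_k = q ^ (n * k) * r@_k.
Proof.
elim/int_ind: n r => [|n IH|n IH] r; first by rewrite mul0r mul1r.
  rewrite -addn1 PoszD aut_powS IH sigma_coef mulrA -expfzDr //.
  by congr (q ^ _ * _); lia.
have -> : - n.+1%:Z = - n%:Z - 1 by lia.
rewrite aut_powV IH sigmaV_coef mulrA -expfzDr //.
by congr (q ^ _ * _); lia.
Qed.

Lemma aut_pow_lvar n : aut_pow sigma n h = q ^ n *: h.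
Proof.
apply/malgP => k; rewrite aut_pow_coef mcoeffZ lmonoE.
by case: eqP => [<-|_]; rewrite ?mulr0 // mulr1.
Qed.

Variables (a : laurent K) (a_neq0 : a != 0).
Local Notation A := (gwa sigma a (mulrC a)).
Local Notation coef := (@gwa_coef K R sigma a (mulrC a)).
Local Notation x := (@gwa_x K R sigma a (mulrC a)).
Local Notation gmon := (@gmon K R sigma a (mulrC a)).
Local Notation gexp := (@gexp K R sigma a (mulrC a)).
Implicit Types (D : der A) (s : R) (u t : A).

Let a_reg r : r * a = 0 -> r = 0.
Proof. exact: lmulf_eq0l. Qed.

Lemma gexpM_lvar z : gexp z * coef h =
  gexp (gmap (fun n s => q ^ n *: (h * s)) z).
Proof.
rewrite gexpM_coef !gexp_gmap; apply: eq_bigr => n _.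
by rewrite aut_pow_lvar -scalerAr mulrC.
Qed.

(* Up to an error supported in degree [n], only degree [n] has weight [q ^ n] under
   conjugation by [h]. *)
Lemma weight_gmon n u r :
  u * coef h = q ^ n *: (coef h * u) + coef r * gmon n ->
  r = 0 /\ exists s, u = coef s * gmon n.
Proof.
have [z ->] := gexp_surj u; rewrite gexpM_lvar scalerAl -linearZ coefM_gexp.
rewrite -gexpU -gexpD => /(gexp_inj a_reg) zE.
(* Comparison of coordinates: in degree [n] the two weights agree and only [r] remains, while
   elsewhere they differ and the coordinate vanishes. *)
have E k : q ^ k *: (h * z@_k) = q ^ n *: (h * z@_k) + r *+ (n == k).
  move/(congr1 (mcoeff k)): zE.
  by rewrite mcoeffD !gmapE ?mulr0 ?scaler0 // mcoeffU -scalerAl.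
have r0 : r = 0 by have := E n; rewrite eqxx => /esym/(canRL (addKr _)); rewrite addNr.
split=> //; exists z@_n; rewrite -gexpU; congr (gexp _); apply/malgP => k.
rewrite mcoeffU; case: eqP => [->//|/eqP nk].
have /eqP := E k; rewrite (negbTE nk) addr0 -subr_eq0 -scalerBl scaler_eq0 subr_eq0.
case/orP => [/eqP/expq_inj kn|/eqP hz]; first by rewrite kn eqxx in nk.
by apply: (@lvarI K); rewrite mulr0.
Qed.

Lemma der_lvar_mod_inner D : exists t r, D (coef h) = ad t (coef h) + coef r.
Proof.
have [z Dz] := gexp_surj (D (coef h)); rewrite Dz.
(* The commutator of s [gmon n] with h is (q^n - 1) h s [gmon n]; [F] solves for s. In degree 0 the
   factor vanishes, so that coordinate stays as [r]. *)
pose F n s : R := if n == 0 then 0 else (q ^ n - 1)^-1 *: (lmono 1 (-1) * s).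
exists (gexp (gmap F z)), z@_0.
rewrite /= /ad_fun gexpM_lvar coefM_gexp -[coef _]mulr1 -[1]/(gmon 0) -gexpU.
rewrite /ad_fun -raddfB -gexpD; congr (gexp _); apply/malgP => k.
have F0 n : F n 0 = 0 by rewrite /F; case: eqP; rewrite ?mulr0 ?scaler0.
rewrite mcoeffD mcoeffB mcoeffU !gmapE ?mulr0 ?scaler0 // /F [0 == k]eq_sym.
case: eqP => [->|/eqP k0]; first by rewrite mulr0 scaler0 subrr add0r.
rewrite addr0 -[X in _ = _ - X]scale1r -scalerBl -scalerAr scalerA mulfV.
  by rewrite mulrA lmono_lvar addNr lmono1 mul1r scale1r.
by rewrite subr_eq0 -(expr0z q); apply: contra_neq k0 => /expq_inj.
Qed.

Lemma ad_is_delta t alpha : is_delta alpha (ad t : der A) -> alpha = 0.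
Proof.
case=> /eqP; rewrite /= /ad_fun subr_eq0 => /eqP th tx _.
(* Commuting with h means weight q^0, so [t] is a coefficient [r]. *)
have [|_ [r tE]] := @weight_gmon 0 t 0.
  by rewrite rmorph0 mul0r addr0 expr0z scale1r.
move: tx; rewrite tE mulr1 gwa_xr -mulrBl -rmorphB /=.
have -> : alpha *: x = coef alpha%:A * x by [].
move=> /(@coef_gmon_inj _ _ _ _ _ a_reg 1)/(congr1 (mcoeff 0)).
(* [sigma] fixes constant coefficients, so that of r - [sigma] r is 0. *)
by rewrite mcoeffB sigma_coef expr0z mul1r subrr mcoeffZ mcoeffUU mulr1.
Qed.

End GWALaurent.

(** * Supports of non-monomials *)

Section NonMonomial.
Variables (K : fieldType) (a : laurent K).
Hypothesis a_not_mono : ~ exists (c : K) (i : int), a = lmono c i.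

Lemma not_mono_neq0 : a != 0.
Proof.
apply: contra_notN a_not_mono => /eqP ->; exists 0, 0.
by rewrite /lmono monalgU0.
Qed.

(** Two exponents with equal image in K differ by a nonzero integer that vanishes in K. So K has
    positive characteristic p, and equality in K is congruence mod p, which genericity forbids for
    the whole support. *)
Lemma not_mono_euler_eigen (m : K) :
  pchar_generic a -> ~ forall k, a@_k != 0 -> k%:~R = m.
Proof.
(* For s = 0 the bound in [extremal] is void: this merely picks a nonzero coefficient. *)
move=> gen_a a_eig; have [j [aj _]] := extremal_ex 0 not_mono_neq0.
have [i [ai ij]] : exists i, a@_i != 0 /\ i != j.
  apply: contrapT => none; apply: a_not_mono; exists a@_j, j.
  apply/malgP => k; rewrite lmonoE; case: eqP => [->//|/eqP jk].
  by apply/eqP; apply: contraT => ak; case: none; exists k; split=> //; rewrite eq_sym.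
have [||p pK] := @natf0_pchar K `|i - j|%N.
- by rewrite absz_gt0 subr_eq0.
- have := a_eig i ai; rewrite -(a_eig j aj) => /eqP; rewrite -subr_eq0 -intrB.
  by case: (i - j) => n; rewrite ?NegzE ?mulrNz ?oppr_eq0 ?abszN absz_nat pmulrn.
apply: (gen_a p pK); exists j => k ak; apply/eqP.
by rewrite eqz_mod_dvd (dvdz_pcharf pK) intrB (a_eig k ak) (a_eig j aj) subrr.
Qed.
End NonMonomial.

(** * Every derivation is inner up to some delta_alpha *)

Section Decomposition.
Variables (K : fieldType) (q : K) (q_neq0 : q != 0).
Hypothesis q_not_root : forall n : nat, (0 < n)%N -> q ^+ n != 1.
Variables (sigma : alg_aut (laurent K)).
Hypothesis sigmaE : sigma (lvar K) = q *: lvar K.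
Variables (a : laurent K).
Hypothesis a_not_mono : ~ exists (c : K) (i : int), a = lmono c i.
Hypothesis a_generic : pchar_generic a.
Local Notation R := (laurent K).
Local Notation A := (gwa sigma a (mulrC a)).
Local Notation coef := (@gwa_coef K R sigma a (mulrC a)).
Local Notation h := (lvar K).
Local Notation x := (@gwa_x K R sigma a (mulrC a)).
Local Notation y := (@gwa_y K R sigma a (mulrC a)).
Implicit Types (D E : der A) (r s f : R) (u t : A) (n k : int).

Let a_neq0 : a != 0 := not_mono_neq0 a_not_mono.
Let a_reg r : r * a = 0 -> r = 0.
Proof. exact: lmulf_eq0l. Qed.

Lemma sigmaV_lvar : aut_inv sigma h = q ^ (-1) *: h.
Proof. exact: (aut_pow_lvar q_neq0 sigmaE (-1)). Qed.

Lemma der_degree0 D r : D (coef h) = coef r -> exists c f g,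
  [/\ D (coef h) = c *: coef h, D x = coef f * x & D y = coef g * y].
Proof.
move=> Dh.
(* This is [D] applied to xh = qhx; the last term measures how far [r] is from being a q-eigenvector
   of [sigma]. *)
have Dx : D x * coef h = q ^ 1 *: (coef h * D x) +
    coef (q *: r - sigma r) * gmon sigma (mulrC a) 1.
  have := derM D x (coef h); rewrite gwa_xr sigmaE linearZ /= -scalerAl.
  rewrite derZ derM Dh gwa_xr.
  move/(canLR (addrK _)) => <-.
  rewrite linearB linearZ /= mulrBl -scalerAl scalerDr expr1z.
  by rewrite [_ + q *: (coef h * _)]addrC -addrA.
have [/eqP rE [f fE]] := weight_gmon q_neq0 q_not_root sigmaE a_neq0 Dx.
rewrite subr_eq0 in rE; move/eqP: rE => rE.
(* The eigenvalue q of [sigma] occurs only in degree 1. *)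
have {}rE : r = r@_1 *: h.
  apply/malgP => k; rewrite mcoeffZ lmonoE.
  case: eqP => [<-|/eqP k1]; rewrite ?mulr1 // mulr0.
  move/(congr1 (mcoeff k)): rE; rewrite mcoeffZ (sigmaC q_neq0 sigmaE).
  move/eqP; rewrite -subr_eq0 -mulrBl mulf_eq0 subr_eq0 => /orP[/eqP qk|/eqP //].
  by move: k1; rewrite (expq_inj q_neq0 q_not_root (qk : q ^ 1 = q ^ k)) eqxx.
have sVr : aut_inv sigma r = q ^ (-1) *: r.
  apply/malgP => k; rewrite (sigmaV_coef q_neq0 sigmaE) rE !mcoeffZ lmonoE.
  by case: eqP => [<-//|_]; rewrite !mulr0.
(* From yh = q^-1 hy; the error term is already 0 because [r] is a multiple of h. *)
have Dy : D y * coef h = q ^ (-1) *: (coef h * D y) +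
    coef 0 * gmon sigma (mulrC a) (-1).
  have := derM D y (coef h); rewrite gwa_yr sigmaV_lvar linearZ /= -scalerAl.
  rewrite derZ derM Dh gwa_yr.
  move/(canLR (addrK _)) => <-.
  by rewrite sVr linearZ rmorph0 /= mul0r addr0 -scalerAl -scalerBr addrAC subrr add0r.
have [_ [g gE]] := weight_gmon q_neq0 q_not_root sigmaE a_neq0 Dy.
by exists r@_1, f, g; split=> //; rewrite Dh [in LHS]rE linearZ.
Qed.

Lemma der_degree0_coefs D c f g :
    D (coef h) = c *: coef h -> D x = coef f * x -> D y = coef g * y ->
  c = 0 /\ g = - aut_inv sigma f.
Proof.
move=> Dh Dx Dy; pose w := g + aut_inv sigma f.
have wE : w * a = c *: euler a.
  apply: (@coef_inj _ _ sigma a (mulrC a) a_reg).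
  rewrite linearZ /= -(der_coef Dh) -gwa_yx derM Dx Dy.
  by rewrite rmorphM rmorphD /= -gwa_yx mulrDl !mulrA gwa_yr.
have wa k : (w * a)@_k = c * k%:~R * a@_k.
  by rewrite wE mcoeffZ diagE mulrA.
(* Since w a = c h a', multiplication by [w] creates no new exponents in [a]. *)
have wC : w = lmono w@_0 0.
  apply: supp_mul_const a_neq0 _ => k; rewrite wa; apply: contra_neq => ->.
  by rewrite mulr0.
have ck k : a@_k != 0 -> c * k%:~R = w@_0.
  move=> ak; apply: (mulIf ak); rewrite -wa {1}wC lmonoME; congr (_ * _).
  by congr mcoeff; lia.
have c0 : c = 0.
  apply/eqP; apply: contraT => c0.
  case: (@not_mono_euler_eigen _ _ a_not_mono (w@_0 / c) a_generic) => k /ck <-.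
  by rewrite mulrC mulKf.
split=> //; apply/eqP; rewrite -addr_eq0; apply/eqP/a_reg.
by rewrite -[_ + _]/w wE c0 scale0r.
Qed.

Lemma der_decomp D : exists t alpha,
  D = ad t + grading_der sigma (mulrC a) alpha.
Proof.
have [t [r Dh]] := der_lvar_mod_inner q_neq0 q_not_root sigmaE D.
pose E := D - ad t.
have [|c [f [g [Eh Ex Ey]]]] := @der_degree0 E r.
  by rewrite -[LHS]/(D _ - ad t _) Dh addrC addKr.
have [c0 gE] := der_degree0_coefs Eh Ex Ey.
(* The junk value [(1 - q ^ 0)^-1 = 0] makes [s] solve [s - sigma s = f] up to the
   constant coefficient of [f]. *)
pose s : R := diag (fun i => (1 - q ^ i)^-1) f.
have fE : f = s - sigma s + lmono f@_0 0.
  apply/malgP => k; rewrite mcoeffD mcoeffB (sigmaC q_neq0 sigmaE) diagE lmonoE.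
  case: eqP => [<-|/eqP k0]; first by rewrite mul1r subrr add0r.
  rewrite addr0 -[X in _ = X - _]mul1r -mulrBl mulVKf // subr_eq0 eq_sym.
  apply: contra_neq k0 => qk.
  by rewrite (expq_inj q_neq0 q_not_root (qk : q ^ k = q ^ 0)).
exists (t + coef s), f@_0.
suff EE : E = ad (coef s) + grading_der sigma (mulrC a) f@_0.
  rewrite -[D](subrK (ad t)) -/E EE addrAC [_ + ad t]addrC; congr (_ + _).
  apply/der_eqP => u; rewrite -[LHS]/(ad_fun t u + ad_fun (coef s) u) /= /ad_fun.
  by rewrite mulrDl mulrDr opprD addrACA.
have sumE u : (ad (coef s) + grading_der sigma (mulrC a) f@_0 : der A) u =
  ad_fun (coef s) u + grading_der sigma (mulrC a) f@_0 u by [].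
apply: der_ext; rewrite sumE ?grading_coef ?grading_x ?grading_y /ad_fun.
- by rewrite Eh c0 scale0r -!rmorphM /= mulrC subrr addr0.
- rewrite Ex gwa_xr -mulrBl -rmorphB -[_ *: x]/(coef (f@_0)%:A * x) -mulrDl -rmorphD.
  rewrite {1}fE; congr (coef (_ + _) * _).
  by rewrite -[1]/(lmono 1 0) lscale_mono mulr1.
- rewrite Ey gE gwa_yr -mulrBl -rmorphB -[_ *: y]/(coef (f@_0)%:A * y) -mulNr -mulrDl.
  rewrite -rmorphN -rmorphD; congr (coef _ * _); apply/malgP => k.
  rewrite -[1]/(lmono 1 0) lscale_mono mulr1.
  (* The value on y needs no new choice: (1 - q^-k) / (1 - q^k) = -q^-k. *)
  rewrite mcoeffD mcoeffB !mcoeffN !(sigmaV_coef q_neq0 sigmaE) diagE lmonoE.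
  case: eqP => [<-|/eqP k0]; first by rewrite oppr0 expr0z !mul1r subrr add0r.
  rewrite subr0 -invr_expz; have Q0 : q ^ k != 0 by rewrite expfz_neq0.
  have Q1 : 1 - q ^ k != 0.
    rewrite subr_eq0 eq_sym; apply: contra_neq k0 => qk.
    by rewrite (expq_inj q_neq0 q_not_root (qk : q ^ k = q ^ 0)).
  by field; rewrite Q0 Q1.
Qed.

End Decomposition.

(** * Uniqueness of the decomposition, and the first cohomology *)

Lemma is_delta_linear (K : comNzRingType) (sigma : alg_aut (laurent K))
    (a : laurent K) (ca : forall r, a * r = r * a) (c alpha beta : K)
    (D E : der (gwa sigma a ca)) :
  is_delta alpha D -> is_delta beta E -> is_delta (c * alpha + beta) (c *: D + E).
Proof.
move=> [Dh Dx Dy] [Eh Ex Ey].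
have sumE u : (c *: D + E) u = c *: D u + E u by [].
split; rewrite sumE ?Dh ?Dx ?Dy ?Eh ?Ex ?Ey.
- by rewrite scaler0 addr0.
- by rewrite scalerA -scalerDl.
- by rewrite scalerN scalerA -opprD -scalerDl.
Qed.

Theorem proposition1p3 (K : fieldType) (q : K) (q_neq0 : q != 0)
    (q_not_root : forall n : nat, (0 < n)%N -> q ^+ n != 1)
    (sigma : alg_aut (laurent K)) (sigmaE : sigma (lvar K) = q *: lvar K)
    (a : laurent K) (a_not_mono : ~ exists (c : K) (i : int), a = lmono c i)
    (a_generic : pchar_generic a) :
  let A := gwa sigma a (mulrC a) in
  [/\ (forall alpha : K, exists! D : der A, is_delta alpha D),
      (forall D : der A, exists! p : der A * der A,
         [/\ exists t : A, p.1 = ad t,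
             exists alpha : K, is_delta alpha p.2 &
             D = p.1 + p.2]) &
      exists phi : {linear HH1 A -> K^o}, bijective phi].
Proof.
move=> A; have a_neq0 := not_mono_neq0 a_not_mono.
pose delta := grading_der sigma (mulrC a).
have decomp (D : der A) : exists (t : A) (alpha : K), D = ad t + delta alpha.
  exact: (der_decomp q_neq0 q_not_root sigmaE a_not_mono a_generic D).
have deltaP alpha : is_delta alpha (delta alpha) by exact: grading_is_delta.
have inner_delta t alpha : is_delta alpha (ad t : der A) -> alpha = 0.
  exact: (ad_is_delta q_neq0 q_not_root sigmaE a_neq0).
have deltaB alpha beta D E : is_delta alpha D -> is_delta beta E ->
    is_delta (alpha - beta) (D - E : der A).
  move=> Da Eb; have := is_delta_linear (-1) Eb Da.
  by rewrite mulN1r scaleN1r [- _ + alpha]addrC [- _ + D]addrC.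
split=> [alpha|D|].
- by exists (delta alpha); split=> // E; apply: is_delta_uniq.
- have [t [alpha DE]] := decomp D.
  exists (ad t, delta alpha); split=> [|[_ E] /= [[t' ->] [beta Eb] DE']].
    by split=> //; [exists t | exists alpha].
  (* Two decompositions of [D] make delta_(alpha - beta) inner, so alpha = beta and all parts
     agree. *)
  have E1 : delta alpha - E = ad t' - ad t.
    by apply/eqP; rewrite subr_eq addrAC eq_sym subr_eq -DE' DE addrC.
  have adB : ad t' - ad t = ad (t' - t) :> der A.
    apply/der_eqP => u; rewrite -[LHS]/(ad_fun t' u - ad_fun t u) /= /ad_fun.
    by rewrite mulrBl mulrBr !opprD !opprK addrACA.
  have ab : alpha = beta.
    apply/eqP; rewrite -subr_eq0; apply/eqP/(inner_delta (t' - t)).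
    by rewrite -adB -E1; apply: deltaB.
  have dE : delta alpha = E by apply: is_delta_uniq Eb; rewrite -ab.
  by move/eqP: E1; rewrite dE subrr eq_sym subr_eq0 => /eqP ->.
(* The isomorphism is built backwards: [cls] is a linear bijection from K, and [phi] is its inverse,
   obtained by choice. *)
pose cls alpha : HH1 A := HH1_class (delta alpha).
have cls_inj : injective cls.
  move=> alpha beta /HH1_classP[t dE]; apply/eqP; rewrite -subr_eq0; apply/eqP.
  by apply: (inner_delta t); rewrite -dE; apply: deltaB.
have cls_surj (w : HH1 A) : exists alpha, cls alpha = w.
  elim/HH1W: w => D; have [t [alpha ->]] := decomp D; exists alpha.
  by apply/esym/HH1_classP; exists t; rewrite addrK.
have cls_linear c alpha beta : cls (c * alpha + beta) = c *: cls alpha + cls beta.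
  rewrite -[c *: _]/(HH1_scale c _) HH1_scaleE -HH1_classD; congr HH1_class.
  exact: is_delta_uniq (deltaP _) (is_delta_linear c (deltaP _) (deltaP _)).
have [f fK] := choice cls_surj.
have f_linear : linear (f : HH1 A -> K^o).
  by move=> c v w; apply: cls_inj; rewrite fK cls_linear !fK.
pose fl := GRing.isLinear.Build K (HH1 A) K^o _ (f : HH1 A -> K^o) f_linear.
pose phi : {linear HH1 A -> K^o} := HB.pack (f : HH1 A -> K^o) fl.
by exists phi, cls => [w|alpha]; [exact: fK | apply: cls_inj; rewrite fK].
Qed.
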